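(* Let $M\ge 1$ be real and let $(a_n)_{n\ge 1}$ be any sequence of elements of $[0,\infty)$. Then the weak projection of the series $\sum_n a_n$ onto $\mathbf{A}_M$ converges in $\mathbf{A}_M$; that is, the sequence $\left(h\left(\sum_{n=1}^k a_n\right)\right)_{k\ge 1}$ converges to an element of $[0,M]$.
   Context: $\mathbf{A}_M=([0,M],\oplus,\otimes,\le)$ with $a\oplus b=\min(M,a+b)$, $a\otimes b=\min(M,a\times b)$, the usual order, and the topology on $[0,M]$ induced from $\mathbb{R}$. The coprojector is $h:[0,\infty)\to[0,M]$, $h(a)=\min(M,a)$. The weak projection of a series $\sum_n a_n$ of elements of $[0,\infty)$ onto $\mathbf{A}_M$ is $h\left(\sum_{n=1}^\infty a_n\right)$, understood as $\lim_{k\to\infty}h\left(\sum_{n=1}^k a_n\right)$ (the series itself may diverge to $+\infty$). *)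

(* Defs.v *)
From HB Require Import structures.
From mathcomp Require Import all_boot all_order all_algebra.
From mathcomp Require Import all_classical all_reals all_analysis.

Set Implicit Arguments.
Unset Strict Implicit.
Unset Printing Implicit Defensive.

Import Order.TTheory GRing.Theory Num.Theory.
Import numFieldNormedType.Exports.

Local Open Scope classical_set_scope.
Local Open Scope ring_scope.

(* Used as a type, this set carries the topology induced from R by the
   inclusion (subtype_topology.v). *)
Definition truncated {R : realType} (M : R) : set R := `[0, M].

Lemma coprojector_subproof {R : realType} (M : R) (hM : 1 <= M)
  (x : {nonneg R}) : Num.min M x%:num \in truncated M.
Proof.
apply/mem_set; rewrite /truncated /= in_itv /= ge_min lexx /= andbT.
by rewrite le_min (le_trans ler01 hM) /=.
Qed.

Definition coprojector {R : realType} (M : R) (hM : 1 <= M)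
  (x : {nonneg R}) : truncated M := SigSub (coprojector_subproof hM x).

Lemma partial_sum_ge0 {R : realType} (a : nat -> {nonneg R}) (k : nat) :
  0 <= \sum_(1 <= n < k.+1) (a n)%:num.
Proof. by apply: sumr_ge0 => n _; exact: ge0. Qed.

(* The sum a 1 + ... + a k: terms are indexed from 1, so a 0 never occurs. *)
Definition partial_sum {R : realType} (a : nat -> {nonneg R}) (k : nat) :
  {nonneg R} := NngNum (partial_sum_ge0 a k).

(* The additional entry at k = 0 is h(0) and is irrelevant to the limit. *)
Definition weak_projection_seq {R : realType} (M : R) (hM : 1 <= M)
  (a : nat -> {nonneg R}) (k : nat) : truncated M :=
  coprojector hM (partial_sum a k).

(* Main.v *)
Require Import Defs.
From HB Require Import structures.
From mathcomp Require Import all_boot all_order all_algebra.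
From mathcomp Require Import all_classical all_reals all_analysis.

Set Implicit Arguments.
Unset Strict Implicit.
Unset Printing Implicit Defensive.

Import Order.TTheory GRing.Theory Num.Theory.
Import numFieldNormedType.Exports.

Local Open Scope classical_set_scope.
Local Open Scope ring_scope.

(** Partial sums of nonnegative terms increase and truncation at [M] preserves order, so the
    truncated sums are monotone and bounded by [M]: they converge in [R] even when the series
    diverges. Closedness of [[0, M]] keeps the limit inside, and [cvg_set_val] moves the convergence
    from [R] to the induced topology. *)

Lemma cvg_set_val (X : topologicalType) (A : set X) (T : Type)
    (F : set_system T) (FF : Filter F) (f : T -> A) (l : A) :
  set_val \o f @ F --> set_val l -> f @ F --> l.
Proof.
(* Open sets of the subtype are exactly the preimages under [set_val] of ambient open sets [W]. *)
move=> fl U; rewrite nbhsE => -[_ [[W oW <-] /= Wl] WU].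
have /fl : nbhs (set_val l) W by exact: open_nbhs_nbhs.
by apply: (@filterS _ F) => t Wt; exact: WU.
Qed.

Lemma partial_sum_nondecreasing (R : realType) (a : nat -> {nonneg R}) :
  nondecreasing_seq (fun k => (partial_sum a k)%:num).
Proof.
by apply/nondecreasing_seqP => k; rewrite /= [leRHS]big_nat_recr //= lerDl.
Qed.

Theorem mainTheorem2 (R : realType) (M : R) (hM : 1 <= M)
    (a : nat -> {nonneg R}) :
  exists l : truncated M, weak_projection_seq hM a @ \oo --> l.
Proof.
pose u k := set_val (weak_projection_seq hM a k).
have uE k : u k = Num.min M (partial_sum a k)%:num by rewrite /u set_valE.
have u_nd : nondecreasing_seq u.
  move=> m n mn; rewrite !uE le_min ge_min lexx /= ge_min.
  by rewrite partial_sum_nondecreasing // orbT.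
have u_bnd k : truncated M (u k) by exact: set_valP.
have u_cvg : cvgn u.
  apply: nondecreasing_is_cvgn => //; exists M => _ [k _ <-].
  by have := u_bnd k; rewrite /truncated /= in_itv => /andP[].
(* A closed set contains the limit of a convergent sequence of its points; this supplies the witness
   in the subtype. *)
have lim_in : truncated M (limn u).
  apply: (@closed_cvg _ _ \oo _ u) u_cvg; first exact: interval_closed.
  exact: nearW.
by exists (SigSub (mem_set lim_in)); apply: cvg_set_val; rewrite set_valE.
Qed.
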